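(* Consider the closed-loop system described in the context with a physically realizable controller given by the Hamiltonian parameterization $a=J_0R+bJb^{T}J_0/2$, $c=J_2\mathbf{I}^{T}b^{T}J_0$, where $R\in\mathbb{S}_n$ and $b\in\mathbb{R}^{n\times(m_2+p)}$, and suppose $\mathcal{A}$ is Hurwitz. Regard $E$ as a function of $(R,b)\in\mathbb{S}_n\times\mathbb{R}^{n\times(m_2+p)}$. Then $(R,b)$ is a critical point of $E$ (i.e. the Fréchet derivatives of $E$ with respect to $R$ and to $b$ both vanish) if and only if there exists a real antisymmetric matrix $\Phi$ of order $n$ such that $$H_{22}=-\Phi J_0$$ and $$\mathfrak{M}(b)+H_{21}\mathbf{C}^{T}+Q_{21}B\mathbf{D}^{T}+J_0\big(H_{12}^{T}B_2+P_{21}C_0^{T}D_0\big)J_2\mathbf{I}^{T}=0,$$ where $\mathfrak{M}$ is the linear operator on $\mathbb{R}^{n\times(m_2+p)}$ given by $$\mathfrak{M}(X):=\Phi XJ+Q_{22}X\mathbf{D}\mathbf{D}^{T}+J_0P_{22}J_0X\mathbf{I}J_2D_0^{T}D_0J_2\mathbf{I}^{T}.$$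
   Context: Let $n=2\nu$, $m_1=2\mu_1$, $m_2=2\mu_2$, and let $p,p_0$ be positive integers. Plant matrices: $A\in\mathbb{R}^{n\times n}$, $B_1\in\mathbb{R}^{n\times m_1}$, $B_2\in\mathbb{R}^{n\times m_2}$, $C\in\mathbb{R}^{p\times n}$, $D\in\mathbb{R}^{p\times m_1}$, $C_0\in\mathbb{R}^{p_0\times n}$, $D_0\in\mathbb{R}^{p_0\times m_2}$. $J_0,J_1,J_2$ are the canonical real antisymmetric matrices of orders $n,m_1,m_2$ (block diagonal with copies of $\begin{bmatrix}0&1\\-1&0\end{bmatrix}$). $J:=\begin{bmatrix}J_2&0\\0&DJ_1D^{T}\end{bmatrix}$, $\mathbf{I}:=\begin{bmatrix}I_{m_2}\\0\end{bmatrix}\in\mathbb{R}^{(m_2+p)\times m_2}$, and $\mathbb{S}_n$ denotes real symmetric $n\times n$ matrices. Controller matrices $a\in\mathbb{R}^{n\times n}$, $b=[\,b_1\ \ b_2\,]\in\mathbb{R}^{n\times(m_2+p)}$ with $b_1\in\mathbb{R}^{n\times m_2}$, $b_2\in\mathbb{R}^{n\times p}$, and $c\in\mathbb{R}^{m_2\times n}$. Set $B:=[\,B_1\ \ B_2\,]$, $\mathbf{C}:=\begin{bmatrix}0\\ C\end{bmatrix}\in\mathbb{R}^{(m_2+p)\times n}$, $\mathbf{D}:=\begin{bmatrix}0 & I_{m_2}\\ D & 0\end{bmatrix}$. Closed-loop matrices: $\mathcal{A}:=\begin{bmatrix}A & B_2c\\ b\mathbf{C} & a\end{bmatrix}$,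 $\mathcal{B}:=\begin{bmatrix}B\\ b\mathbf{D}\end{bmatrix}$, $\mathcal{C}:=\begin{bmatrix}C_0 & D_0c\end{bmatrix}$. When $\mathcal{A}$ is Hurwitz, $P,Q$ are the unique solutions of $\mathcal{A}P+P\mathcal{A}^{T}+\mathcal{B}\mathcal{B}^{T}=0$, $\mathcal{A}^{T}Q+Q\mathcal{A}+\mathcal{C}^{T}\mathcal{C}=0$; $E:=\mathrm{Tr}(\mathcal{C}P\mathcal{C}^{T})$; $H:=QP$. $H,P,Q$ are partitioned into $n\times n$ blocks $H_{jk},P_{jk},Q_{jk}$, $j,k\in\{1,2\}$. Derivatives are Fréchet derivatives with respect to the Frobenius inner product (for $R$, on the space $\mathbb{S}_n$). *)

(* Defs.v *)
From mathcomp Require Import all_boot all_order all_algebra.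
From mathcomp Require Import all_classical all_reals all_analysis.
Set Implicit Arguments. Unset Strict Implicit. Unset Printing Implicit Defensive.
Import Order.TTheory GRing.Theory Num.Theory numFieldNormedType.Exports.
From mathcomp Require Import complex.
Local Open Scope ring_scope.
Local Open Scope classical_set_scope.

Section Defs.
Variable R : realType.

(* canonical real antisym_mx matrix of order 2k: block diagonal with k
   copies of [[0,1],[-1,0]] *)
Definition canonJ (k : nat) : 'M[R]_(k.*2) :=
  \matrix_(i, j) (if ~~ odd i && (j == i.+1 :> nat) then 1
                  else if odd i && (j.+1 == i :> nat) then -1 else 0).

Definition sym_mx {k} (M : 'M[R]_k) : Prop := M^T = M.
Definition antisym_mx {k} (M : 'M[R]_k) : Prop := M^T = - M.

Definition hurwitz {k} (M : 'M[R]_k) : Prop :=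
  forall z : R[i], eigenvalue (map_mx (real_complex R) M) z -> complex.Re z < 0.

(* the solution X of  M X + X M^T + W = 0 (unique when M is Hurwitz) *)
Definition lyap {k} (M W : 'M[R]_k) : 'M[R]_k :=
  xget 0 [set X : 'M[R]_k | M *m X + X *m M^T + W = 0].

Variables (nu mu1 mu2 p p0 : nat).
Notation n := (nu.*2).
Notation m1 := (mu1.*2).
Notation m2 := (mu2.*2).
Variables (A : 'M[R]_n) (B1 : 'M[R]_(n, m1)) (B2 : 'M[R]_(n, m2))
  (C : 'M[R]_(p, n)) (D : 'M[R]_(p, m1)) (C0 : 'M[R]_(p0, n))
  (D0 : 'M[R]_(p0, m2)).

Definition J0 : 'M[R]_n := canonJ nu.
Definition J1 : 'M[R]_m1 := canonJ mu1.
Definition J2 : 'M[R]_m2 := canonJ mu2.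
Definition Jbig : 'M[R]_(m2 + p) := block_mx J2 0 0 (D *m J1 *m D^T).
Definition Ibold : 'M[R]_(m2 + p, m2) := col_mx 1%:M 0.
Definition Bfull : 'M[R]_(n, m1 + m2) := row_mx B1 B2.
Definition Cbold : 'M[R]_(m2 + p, n) := col_mx 0 C.
Definition Dbold : 'M[R]_(m2 + p, m1 + m2) := block_mx 0 1%:M D 0.

Definition ctrl_a (Rm : 'M[R]_n) (b : 'M[R]_(n, m2 + p)) : 'M[R]_n :=
  J0 *m Rm + 2^-1 *: (b *m Jbig *m b^T *m J0).
Definition ctrl_c (b : 'M[R]_(n, m2 + p)) : 'M[R]_(m2, n) :=
  J2 *m Ibold^T *m b^T *m J0.

Definition Acl Rm b : 'M[R]_(n + n) :=
  block_mx A (B2 *m ctrl_c b) (b *m Cbold) (ctrl_a Rm b).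
Definition Bcl (b : 'M[R]_(n, m2 + p)) : 'M[R]_(n + n, m1 + m2) :=
  col_mx Bfull (b *m Dbold).
Definition Ccl (b : 'M[R]_(n, m2 + p)) : 'M[R]_(p0, n + n) :=
  row_mx C0 (D0 *m ctrl_c b).

Definition Pcl Rm b : 'M[R]_(n + n) := lyap (Acl Rm b) (Bcl b *m (Bcl b)^T).
Definition Qcl Rm b : 'M[R]_(n + n) := lyap ((Acl Rm b)^T) ((Ccl b)^T *m Ccl b).
Definition Ecost Rm b : R := \tr (Ccl b *m Pcl Rm b *m (Ccl b)^T).
Definition Hcl Rm b : 'M[R]_(n + n) := Qcl Rm b *m Pcl Rm b.

Definition Efun (x : 'M[R]_n * 'M[R]_(n, m2 + p)) : R := Ecost x.1 x.2.

Definition critical (Rm : 'M[R]_n) (b : 'M[R]_(n, m2 + p)) : Prop :=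
  let x : 'M[R]_n * 'M[R]_(n, m2 + p) := (Rm, b) in
  differentiable Efun x /\
  forall (dR : 'M[R]_n) (db : 'M[R]_(n, m2 + p)),
    sym_mx dR -> 'd Efun x (dR, db) = 0.

Definition frakM (Phi Q22 P22 : 'M[R]_n) (X : 'M[R]_(n, m2 + p)) :
  'M[R]_(n, m2 + p) :=
  Phi *m X *m Jbig + Q22 *m X *m Dbold *m Dbold^T
  + J0 *m P22 *m J0 *m X *m Ibold *m J2 *m D0^T *m D0 *m J2 *m Ibold^T.

End Defs.

(* Main.v *)
Require Import Defs.
From HB Require Import structures.
From mathcomp Require Import all_boot all_order all_algebra.
From mathcomp Require Import all_classical all_reals all_analysis.
Import Order.TTheory GRing.Theory Num.Theory numFieldNormedType.Exports.
From mathcomp Require Import perm complex zify ring.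
Set Implicit Arguments. Unset Strict Implicit. Unset Printing Implicit Defensive.
Local Open Scope ring_scope.
Local Open Scope classical_set_scope.

(** Since [A] is Hurwitz, the Lyapunov operator [X |-> A X + X A^T] is
    invertible, and by Cramer's rule the Gramian [P] is a rational function of
    [(R, b)] near the given point; hence [E] is differentiable. Differentiating
    the equation of [P] and pairing it with [Q] gives
    [dE = 2 (<Q P, dA> + <Q B, dB> + <C P, dC>)]. The derivative in [R] vanishes
    on symmetric matrices iff [J0^T H22] is antisymmetric, that is, iff
    [Phi := H22 J0] is; then the pairing with [db] is represented by the
    left-hand side of the second equation. *)

(** * Differentials depend only on the germ of a function *)

Section LocalEquality.
Variables (R : realType) (V W : normedModType R).

(** The first-order expansion of [f] at [x] is also one for [g], because the two remainders coincide
    near 0; [diff_unique] then identifies the differentials. This lets an explicit formula valid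
    only near [x] stand in for an inverse or a Gramian. *)
Lemma near_eq_differentiable (f g : V -> W) (x : V) :
  (\forall y \near x, f y = g y) -> differentiable f x ->
  differentiable g x /\ 'd g x = 'd f x :> (V -> W).
Proof.
move=> fg df.
have fgx : f x = g x by exact: nbhs_singleton fg.
have key : g \o shift x = cst (g x) + 'd f x +o_ (0 : V) id.
  apply/eqaddoP => e e0.
  have /eqaddoP/(_ e e0) fo := diff_locally df.
  have fg0 : \forall y \near (0 : V), f (y + x) = g (y + x).
    suff shx : shift x y @[y --> (0 : V)] --> x by exact: shx fg.
    rewrite -[X in _ --> X]add0r.
    by apply: cvgD; [exact: cvg_id|exact: cvg_cst].
  near=> y.
  have -> : (g \o shift x - (cst (g x) + 'd f x)) y =
            (f \o shift x - (cst (f x) + 'd f x)) y.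
    rewrite /= !fctE /= fgx; congr (_ - _); apply/esym.
    by near: y.
  by near: y.
have dgE := diff_unique (diff_continuous df) key.
split => //; apply/diff_locallyP; rewrite dgE.
by split => //; exact: diff_continuous.
Unshelve. all: by end_near. Qed.

End LocalEquality.

(** * Calculus of directional derivatives for matrix-valued maps *)

Section MatrixDifferential.
Variables (R : realType) (V : normedModType R) (x v : V).

(** The direction [v] is fixed, so that the calculus rules are identities between numbers or
    matrices and no linear map has to be built. Differentiability is a separate conjunct because
    ['d] is total and its value alone does not imply it. *)
Definition has_diff (f : V -> R) (d : R) : Prop :=
  differentiable f x /\ 'd f x v = d.

Definition mx_has_diff m n (f : V -> 'M[R]_(m, n)) (d : 'M[R]_(m, n)) : Prop :=
  forall i j, has_diff (fun y => f y i j) (d i j).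

Lemma has_diff_cst (a : R) : has_diff (fun=> a) 0.
Proof. by split; [exact: differentiable_cst|rewrite diff_cst]. Qed.

Lemma has_diffD f g df dg : has_diff f df -> has_diff g dg ->
  has_diff (fun y => f y + g y) (df + dg).
Proof.
move=> [f1 <-] [g1 <-]; split; first exact: differentiableD.
exact: (congr1 (fun h => h v) (diffD f1 g1)).
Qed.

Lemma has_diffM f g df dg : has_diff f df -> has_diff g dg ->
  has_diff (fun y => f y * g y) (df * g x + f x * dg).
Proof.
move=> [f1 <-] [g1 <-]; split; first exact: differentiableM.
have E := congr1 (fun h => h v) (diffM f1 g1).
change ('d (f * g) x v = 'd f x v * g x + f x * 'd g x v).
by rewrite E [RHS]addrC [_ * g x]mulrC.
Qed.

Lemma has_diff_sum (I : Type) (r : seq I) (P : pred I) (f : I -> V -> R) df :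
  (forall i, has_diff (f i) (df i)) ->
  has_diff (fun y => \sum_(i <- r | P i) f i y) (\sum_(i <- r | P i) df i).
Proof.
move=> fP; elim: r => [|i r IH].
  rewrite big_nil (_ : (fun y => _) = fun=> 0); first exact: has_diff_cst.
  by apply/funext => y; rewrite big_nil.
rewrite big_cons (_ : (fun y => _) =
  fun y => if P i then f i y + \sum_(j <- r | P j) f j y
           else \sum_(j <- r | P j) f j y); last first.
  by apply/funext => y; rewrite big_cons.
by case: (P i) => //; exact: has_diffD.
Qed.

Lemma near_eq_mx_has_diff m n (f g : V -> 'M[R]_(m, n)) d :
  (\forall y \near x, f y = g y) -> mx_has_diff f d -> mx_has_diff g d.
Proof.
move=> fg fd i j; have [f1 f2] := fd i j.
have [|g1 g2] := @near_eq_differentiable _ _ _ _ (fun y => g y i j) _ _ f1.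
  by apply: filterS fg => y ->.
by split => //; rewrite g2.
Qed.

Lemma mx_has_diff_uniq m n (f : V -> 'M[R]_(m, n)) d d' :
  mx_has_diff f d -> mx_has_diff f d' -> d = d'.
Proof. by move=> h h'; apply/matrixP => i j; rewrite -(h i j).2 -(h' i j).2. Qed.

Lemma mx_has_diff_cst m n (a : 'M[R]_(m, n)) : mx_has_diff (fun=> a) 0.
Proof. by move=> i j; rewrite mxE; exact: has_diff_cst. Qed.

Lemma mx_has_diffD m n (f g : V -> 'M[R]_(m, n)) df dg :
  mx_has_diff f df -> mx_has_diff g dg ->
  mx_has_diff (fun y => f y + g y) (df + dg).
Proof.
move=> fd gd i j; rewrite mxE (_ : (fun y => _) = fun y => f y i j + g y i j).
  exact: has_diffD.
by apply/funext => y; rewrite mxE.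
Qed.

Lemma mx_has_diffM m n k (f : V -> 'M[R]_(m, n)) (g : V -> 'M[R]_(n, k)) df dg :
  mx_has_diff f df -> mx_has_diff g dg ->
  mx_has_diff (fun y => f y *m g y) (df *m g x + f x *m dg).
Proof.
move=> fd gd i j.
rewrite (_ : (fun y => _) = fun y => \sum_l f y i l * g y l j); last first.
  by apply/funext => y; rewrite mxE.
rewrite !mxE -big_split /=; apply: has_diff_sum => l.
exact: has_diffM.
Qed.

Lemma mx_has_diffMl m n k (a : 'M[R]_(m, n)) (g : V -> 'M[R]_(n, k)) dg :
  mx_has_diff g dg -> mx_has_diff (fun y => a *m g y) (a *m dg).
Proof.
by move=> gd; have := mx_has_diffM (mx_has_diff_cst a) gd; rewrite mul0mx add0r.
Qed.

Lemma mx_has_diffMr m n k (f : V -> 'M[R]_(m, n)) (a : 'M[R]_(n, k)) df :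
  mx_has_diff f df -> mx_has_diff (fun y => f y *m a) (df *m a).
Proof.
by move=> fd; have := mx_has_diffM fd (mx_has_diff_cst a); rewrite mulmx0 addr0.
Qed.

Lemma mx_has_diffZ m n (a : R) (f : V -> 'M[R]_(m, n)) df :
  mx_has_diff f df -> mx_has_diff (fun y => a *: f y) (a *: df).
Proof.
move=> fd; have := mx_has_diffMl a%:M fd.
rewrite mul_scalar_mx; under eq_fun do rewrite mul_scalar_mx.
by [].
Qed.

Lemma mx_has_diff_tr m n (f : V -> 'M[R]_(m, n)) df :
  mx_has_diff f df -> mx_has_diff (fun y => (f y)^T) df^T.
Proof.
move=> fd i j; rewrite mxE; under eq_fun do rewrite mxE.
exact: fd.
Qed.

Lemma mx_has_diff_col m1 m2 n (f : V -> 'M[R]_(m1, n)) (g : V -> 'M[R]_(m2, n))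
    df dg : mx_has_diff f df -> mx_has_diff g dg ->
  mx_has_diff (fun y => col_mx (f y) (g y)) (col_mx df dg).
Proof.
move=> fd gd i j; rewrite mxE; under eq_fun do rewrite mxE.
by case: splitP => k _.
Qed.

Lemma mx_has_diff_row m n1 n2 (f : V -> 'M[R]_(m, n1)) (g : V -> 'M[R]_(m, n2))
    df dg : mx_has_diff f df -> mx_has_diff g dg ->
  mx_has_diff (fun y => row_mx (f y) (g y)) (row_mx df dg).
Proof.
move=> fd gd i j; rewrite mxE; under eq_fun do rewrite mxE.
by case: splitP => k _.
Qed.

Lemma mx_has_diff_block m1 m2 n1 n2 (f : V -> 'M[R]_(m1, n1))
    (g : V -> 'M[R]_(m1, n2)) (h : V -> 'M[R]_(m2, n1))
    (k : V -> 'M[R]_(m2, n2)) df dg dh dk :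
  mx_has_diff f df -> mx_has_diff g dg -> mx_has_diff h dh -> mx_has_diff k dk ->
  mx_has_diff (fun y => block_mx (f y) (g y) (h y) (k y)) (block_mx df dg dh dk).
Proof.
move=> fd gd hd kd.
by apply: mx_has_diff_col; apply: mx_has_diff_row.
Qed.

Lemma has_diff_mxtrace n (f : V -> 'M[R]_n) df :
  mx_has_diff f df -> has_diff (fun y => \tr (f y)) (\tr df).
Proof. by move=> fd; apply: has_diff_sum => i; exact: fd. Qed.

End MatrixDifferential.

(** * Differentiability of determinant, adjugate and inverse *)

Section MatrixInverseDifferential.
Variables (R : realType) (V : normedModType R) (x : V).

Definition mx_differentiable m n (f : V -> 'M[R]_(m, n)) : Prop :=
  forall i j, differentiable (fun y => f y i j) x.

Lemma mx_differentiableP m n (f : V -> 'M[R]_(m, n)) :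
  mx_differentiable f -> forall v, exists d, mx_has_diff x v f d.
Proof.
move=> fd v; exists (\matrix_(i, j) 'd (fun y => f y i j) x v) => i j.
by rewrite mxE; split => //; exact: fd.
Qed.

Lemma differentiable_prod (I : Type) (r : seq I) (P : pred I) (f : I -> V -> R) :
  (forall i, differentiable (f i) x) ->
  differentiable (fun y => \prod_(i <- r | P i) f i y) x.
Proof.
move=> fP; elim: r => [|i r IH].
  rewrite (_ : (fun y => _) = fun=> 1); first exact: differentiable_cst.
  by apply/funext => y; rewrite big_nil.
rewrite (_ : (fun y => _) =
  fun y => if P i then f i y * \prod_(j <- r | P j) f j y
           else \prod_(j <- r | P j) f j y); last first.
  by apply/funext => y; rewrite big_cons.
by case: (P i) => //; exact: differentiableM.
Qed.

Lemma differentiable_det n (f : V -> 'M[R]_n) :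
  mx_differentiable f -> differentiable (fun y => \det (f y)) x.
Proof.
move=> fd.
have h s : differentiable (fun y => (-1) ^+ odd_perm s *
    \prod_(i < n) f y i (s i) : R) x.
  apply: differentiableM; first exact: differentiable_cst.
  by apply: differentiable_prod => i; exact: fd.
rewrite /determinant.
(* The direction 0 is a placeholder: only the differentiability half of [has_diff_sum] is kept. *)
have [] // := @has_diff_sum _ _ x 0 _ (index_enum {perm 'I_n}) predT
  (fun s y => (-1) ^+ odd_perm s * \prod_(i < n) f y i (s i))
  (fun s => 'd (fun y => (-1) ^+ odd_perm s * \prod_(i < n) f y i (s i)) x 0).
Qed.

Lemma mx_differentiable_adj n (f : V -> 'M[R]_n) :
  mx_differentiable f -> mx_differentiable (fun y => \adj (f y)).
Proof.
move=> fd i j; under eq_fun do rewrite mxE.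
apply: differentiableM; first exact: differentiable_cst.
apply: differentiable_det => k l; under eq_fun do rewrite !mxE.
exact: fd.
Qed.

Lemma mx_differentiable_inv n (f : V -> 'M[R]_n) :
  f x \in unitmx -> mx_differentiable f ->
  (\forall y \near x, f y \in unitmx) /\ mx_differentiable (fun y => invmx (f y)).
Proof.
move=> fx fd; have dd := differentiable_det fd.
have d0 : \det (f x) != 0 by rewrite -unitfE -unitmxE.
have near_unit : \forall y \near x, f y \in unitmx.
  have : \forall y \near x, \det (f y) != 0.
    have := @differentiable_continuous _ _ _ _ _ dd.
    by move=> /(_ [set r | r != 0]); apply; exact: open_nbhs_nbhs.
  by apply: filterS => y; rewrite unitmxE unitfE.
split => // i j.
(* Cramer's rule gives the inverse wherever the determinant is nonzero, which by continuity is a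
   neighbourhood of [x]. *)
have [||//] := @near_eq_differentiable _ _ _
  (fun y => (\det (f y))^-1 * \adj (f y) i j) (fun y => invmx (f y) i j) x.
  by apply: filterS near_unit => y fy; rewrite /invmx fy [RHS]mxE.
by apply: differentiableM; [exact: differentiableV|exact: mx_differentiable_adj].
Qed.

End MatrixInverseDifferential.

(** * Sylvester and Lyapunov equations *)

Section Lyapunov.
Variable R : realType.

Lemma horner_mx_intertwine (F : fieldType) k (M N X : 'M[F]_k.+1) (q : {poly F}) :
  M *m X = X *m N -> horner_mx M q *m X = X *m horner_mx N q.
Proof.
move=> MX; elim/poly_ind: q => [|q c IH]; first by rewrite !rmorph0 mulmx0 mul0mx.
rewrite !rmorphD !rmorphM /= !horner_mx_X !horner_mx_C.
by rewrite mulmxDl mulmxDr -!mulmxE -mulmxA MX mulmxA IH scalar_mxC mulmxA.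
Qed.

(* [X] intertwines [q(M)] and [q(N)] for every polynomial [q]; take [q] to be the
   characteristic polynomial of [N], so that [q(N) = 0] and [q(M)] is invertible. *)
Lemma sylvester_eq0 (F : closedFieldType) k (M N X : 'M[F]_k) :
  (forall z, eigenvalue N z -> ~~ eigenvalue M z) ->
  M *m X = X *m N -> X = 0.
Proof.
case: k M N X => [|k] M N X MN MX; first by apply/matrixP => -[].
have [s sE] := closed_field_poly_normal (char_poly N).
rewrite (monicP (char_poly_monic N)) scale1r in sE.
(* Over a closed field this is a product of factors [M - z] with [z] an eigenvalue of [N]; each is
   invertible since [z] is not an eigenvalue of [M]. *)
have U : horner_mx M (char_poly N) \in unitmx.
  have sN0 : {subset s <= eigenvalue N}.
    by move=> z zs; rewrite [_ \in _]eigenvalue_root_char sE root_prod_XsubC.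
  rewrite {}sE; elim: s sN0 => [|z s IH] sN; first by rewrite big_nil rmorph1 unitmx1.
  rewrite big_cons rmorphM -mulmxE unitmx_mul IH ?andbT; last first.
    by move=> y ys; apply: sN; rewrite inE ys orbT.
  have /MN : eigenvalue N z by apply: sN; rewrite inE eqxx.
  rewrite rmorphB /= horner_mx_X horner_mx_C /eigenvalue negbK => /eqP K0.
  by rewrite -row_free_unit -kermx_eq0; apply/eqP.
have := horner_mx_intertwine (char_poly N) MX.
rewrite Cayley_Hamilton mulmx0 => /(congr1 (mulmx (invmx (horner_mx M (char_poly N))))).
by rewrite mulKmx // mulmx0.
Qed.

Lemma hurwitz_tr k (M : 'M[R]_k) : hurwitz M -> hurwitz M^T.
Proof.
move=> hM z hz; apply: hM; move: hz.
rewrite !eigenvalue_root_char -map_trmx /char_poly /char_poly_mx.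
by rewrite -det_tr linearB /= tr_scalar_mx !map_trmx trmxK.
Qed.

(** Over the complex numbers [X] intertwines [M] and [- M^T]. The spectrum of [M] lies in the open
    left half-plane and that of [- M^T] in the open right one, so they are disjoint and
    [sylvester_eq0] applies. *)
Lemma lyapunov_eq0 k (M X : 'M[R]_k) :
  hurwitz M -> M *m X + X *m M^T = 0 -> X = 0.
Proof.
move=> hM /eqP; rewrite addr_eq0 -mulmxN => /eqP MX.
apply: (@map_mx_inj _ _ (real_complex R)); rewrite map_mx0.
apply: (@sylvester_eq0 _ _ (map_mx (real_complex R) M)
  (map_mx (real_complex R) (- M^T))); last first.
  by rewrite -!map_mxM MX.
move=> z; rewrite map_mxN => /eigenvalueP [u uM u0].
apply/negP => /hM zlt.
have : complex.Re (- z) < 0.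
  apply: (hurwitz_tr hM); apply/eigenvalueP; exists u => //.
  by rewrite scaleNr -uM mulmxN opprK.
by case: z zlt {uM} => a c /=; rewrite oppr_lt0 => /lt_trans /[apply]; rewrite ltxx.
Qed.

(** The Kronecker sum representing the Lyapunov operator on vectorized matrices, so that solving the
    equation becomes inverting a matrix. *)
Definition lyap_mx k (M : 'M[R]_k) : 'M[R]_(k * k) :=
  lin_mulmx M + lin_mulmxr M^T.

Lemma mul_lyap_mx k (M X : 'M[R]_k) :
  mxvec X *m lyap_mx M = mxvec (M *m X + X *m M^T).
Proof. by rewrite mulmxDr !mul_vec_lin /= -linearD. Qed.

Lemma lyap_mx_unit k (M : 'M[R]_k) : hurwitz M -> lyap_mx M \in unitmx.
Proof.
move=> hM; rewrite -row_free_unit; apply: inj_row_free => u.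
rewrite -[u]vec_mxK mul_lyap_mx => /eqP; rewrite mxvec_eq0 => /eqP.
by move=> /(lyapunov_eq0 hM) ->; rewrite linear0.
Qed.

(** Invertibility makes the solution set a singleton, so [xget] returns its element and not the
    default 0. The hypothesis is on [lyap_mx M] because its invertibility persists near a given
    point by continuity of the determinant. *)
Lemma lyapE k (M W : 'M[R]_k) : lyap_mx M \in unitmx ->
  lyap M W = vec_mx (mxvec (- W) *m invmx (lyap_mx M)).
Proof.
move=> U; rewrite /lyap; apply: xget_unique => [|Y] /=.
  apply: (can_inj mxvecK); rewrite linearD /= -mul_lyap_mx vec_mxK mulmxKV //.
  by rewrite linearN /= addNr linear0.
move=> /eqP; rewrite addr_eq0 => /eqP <-.
by rewrite -mul_lyap_mx mulmxK // mxvecK.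
Qed.

Lemma lyapP k (M W : 'M[R]_k) : lyap_mx M \in unitmx ->
  M *m lyap M W + lyap M W *m M^T + W = 0.
Proof.
move=> U; rewrite lyapE //; apply: (can_inj mxvecK).
rewrite linearD /= -mul_lyap_mx vec_mxK mulmxKV //.
by rewrite linearN /= addNr linear0.
Qed.

(** Transposing the equation shows that the transpose is a solution too; uniqueness concludes. *)
Lemma lyap_sym k (M W : 'M[R]_k) : hurwitz M -> W^T = W ->
  (lyap M W)^T = lyap M W.
Proof.
move=> hM WT; apply/eqP; rewrite -subr_eq0; apply/eqP; apply: (lyapunov_eq0 hM).
have E := lyapP W (lyap_mx_unit hM).
have E' := congr1 trmx E; rewrite !linearD /= !trmx_mul trmxK WT trmx0 in E'.
rewrite mulmxBr mulmxBl addrACA -opprD; apply/eqP; rewrite subr_eq0; apply/eqP.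
by apply: (addIr W); rewrite E -E' [_ *m M^T + _]addrC.
Qed.

End Lyapunov.

(** * Differentiability of the Lyapunov solution *)

Section LyapunovDifferential.
Variables (R : realType) (V : normedModType R) (x v : V).

Lemma has_diff_linear (f : V -> R) : linear f -> continuous f ->
  has_diff x v f (f v).
Proof.
move=> flin fcont.
pose fM := GRing.isLinear.Build _ _ _ _ _ flin.
pose fL : {linear V -> R} := HB.pack f fM.
split; first exact: (@linear_differentiable _ _ _ fL).
by rewrite (@diff_lin _ _ _ fL).
Qed.

(** Row [i] of [lyap_mx] is the Lyapunov operator applied to the [i]-th basis matrix, hence each
    entry is linear in [M]. *)
Lemma mx_differentiable_lyap_mx k (M : V -> 'M[R]_k) d :
  mx_has_diff x v M d -> mx_differentiable x (fun y => lyap_mx (M y)).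
Proof.
move=> Md i j; pose X := vec_mx (delta_mx 0 i) : 'M[R]_k.
have E y : lyap_mx (M y) i j = mxvec (M y *m X + X *m (M y)^T) 0 j.
  by rewrite -mul_lyap_mx /X vec_mxK -rowE [RHS]mxE.
under eq_fun do rewrite E.
case/mxvec_indexP: j {E} => a c.
under eq_fun do rewrite mxvecE.
have H := mx_has_diffD (mx_has_diffMr X Md) (mx_has_diffMl X (mx_has_diff_tr Md)).
exact: (H a c).1.
Qed.

(** The derivative is left existential, since the adjoint method eliminates it. The neighbourhood of
    invertibility is returned as well: on it the Lyapunov equation holds and can be
    differentiated. *)
Lemma mx_differentiable_lyap k (M W : V -> 'M[R]_k) dM dW :
  hurwitz (M x) -> mx_has_diff x v M dM -> mx_has_diff x v W dW ->
  (\forall y \near x, lyap_mx (M y) \in unitmx) /\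
  exists d, mx_has_diff x v (fun y => lyap (M y) (W y)) d.
Proof.
move=> hM Md Wd.
have [near_unit inv_d] := @mx_differentiable_inv _ _ x _
  (fun y => lyap_mx (M y)) (lyap_mx_unit hM)
  (mx_differentiable_lyap_mx Md).
split => //.
have [N Nd] := mx_differentiableP inv_d v.
have [N' N'd] : exists d, mx_has_diff x v (fun y => mxvec (- W y)) d.
  exists (mxvec (-1 *: dW)) => i j; rewrite (ord1 i).
  case/mxvec_indexP: j => a c; under eq_fun do rewrite mxvecE -scaleN1r.
  by rewrite mxvecE; exact: (mx_has_diffZ (-1) Wd).
have Kd := mx_has_diffM N'd Nd.
exists (vec_mx (N' *m invmx (lyap_mx (M x)) + mxvec (- W x) *m N)).
apply: (@near_eq_mx_has_diff _ _ _ _ _ _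
  (fun y => vec_mx (mxvec (- W y) *m invmx (lyap_mx (M y))))).
  by apply: filterS near_unit => y /lyapE ->.
move=> i j; rewrite mxE; under eq_fun do rewrite mxE.
exact: Kd.
Qed.

End LyapunovDifferential.

(** * Derivatives of the two coordinates of the parameter pair *)

Section Projections.
Variables (R : realType) (m1 n1 m2 n2 : nat).
Notation V := ('M[R]_(m1, n1) * 'M[R]_(m2, n2))%type.

Lemma mx_has_diff_fst (x v : V) : mx_has_diff x v (fun y : V => y.1) v.1.
Proof.
move=> i j; apply: (@has_diff_linear _ _ x v (fun y : V => y.1 i j)).
  by move=> a y z; rewrite /= !mxE.
move=> y; apply: (@cvg_comp _ _ _ fst (fun M : 'M[R]_(m1, n1) => M i j)).
  exact: cvg_fst.
exact: coord_continuous.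
Qed.

Lemma mx_has_diff_snd (x v : V) : mx_has_diff x v (fun y : V => y.2) v.2.
Proof.
move=> i j; apply: (@has_diff_linear _ _ x v (fun y : V => y.2 i j)).
  by move=> a y z; rewrite /= !mxE.
move=> y; apply: (@cvg_comp _ _ _ snd (fun M : 'M[R]_(m2, n2) => M i j)).
  exact: cvg_snd.
exact: coord_continuous.
Qed.

End Projections.

(** * Frobenius inner product and the adjoint method *)

Section FrobeniusProduct.
Variable R : realType.

Definition frob m n (X Y : 'M[R]_(m, n)) : R := \tr (X^T *m Y).

Lemma frobC m n (X Y : 'M[R]_(m, n)) : frob X Y = frob Y X.
Proof. by rewrite /frob -mxtrace_tr trmx_mul trmxK. Qed.

Lemma frobDl m n (X Y Z : 'M[R]_(m, n)) : frob (X + Y) Z = frob X Z + frob Y Z.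
Proof. by rewrite /frob linearD /= mulmxDl mxtraceD. Qed.

Lemma frobDr m n (X Y Z : 'M[R]_(m, n)) : frob X (Y + Z) = frob X Y + frob X Z.
Proof. by rewrite /frob mulmxDr mxtraceD. Qed.

Lemma frobNl m n (X Y : 'M[R]_(m, n)) : frob (- X) Y = - frob X Y.
Proof. by rewrite /frob linearN mulNmx linearN. Qed.

Lemma frobNr m n (X Y : 'M[R]_(m, n)) : frob X (- Y) = - frob X Y.
Proof. by rewrite /frob mulmxN linearN. Qed.

Lemma frobZr m n a (X Y : 'M[R]_(m, n)) : frob X (a *: Y) = a * frob X Y.
Proof. by rewrite /frob -scalemxAr linearZ. Qed.

Lemma frob0r m n (X : 'M[R]_(m, n)) : frob X 0 = 0.
Proof. by rewrite /frob mulmx0 linear0. Qed.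

Lemma frob0l m n (X : 'M[R]_(m, n)) : frob 0 X = 0.
Proof. by rewrite frobC frob0r. Qed.

Lemma frob_mull m n k (X : 'M[R]_(m, n)) (Y : 'M[R]_(m, k)) Z :
  frob X (Y *m Z) = frob (Y^T *m X) Z.
Proof. by rewrite /frob trmx_mul trmxK mulmxA. Qed.

Lemma frob_mulr m n k (X : 'M[R]_(m, n)) (Y : 'M[R]_(m, k)) Z :
  frob X (Y *m Z) = frob (X *m Z^T) Y.
Proof. by rewrite /frob trmx_mul trmxK mulmxA mxtrace_mulC mulmxA. Qed.

Lemma frob_tr m n (X : 'M[R]_(m, n)) Y : frob X Y^T = frob X^T Y.
Proof. by rewrite /frob trmxK -trmx_mul mxtrace_tr mxtrace_mulC. Qed.

Lemma frob_eq0 m n (X : 'M[R]_(m, n)) : frob X X = 0 -> X = 0.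
Proof.
rewrite /frob /mxtrace => E; apply/matrixP => i j; rewrite [RHS]mxE.
have pos k : 0 <= \sum_l X l k ^+ 2 by apply: sumr_ge0 => l _; exact: sqr_ge0.
have E' : \sum_k \sum_l X l k ^+ 2 = 0.
  rewrite -[RHS]E; apply: eq_bigr => k _; rewrite mxE.
  by apply: eq_bigr => l _; rewrite mxE.
have /eqP Ej := @psumr_eq0P _ _ _ _ (fun k _ => pos k) E' j isT.
rewrite psumr_eq0 // in Ej; last by move=> l _; exact: sqr_ge0.
by move/allP/(_ i (mem_index_enum i)): Ej; rewrite sqrf_eq0 => /eqP.
Qed.

Lemma frob_col m1 m2 n (X : 'M[R]_(m1 + m2, n)) Y Z :
  frob X (col_mx Y Z) = frob (usubmx X) Y + frob (dsubmx X) Z.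
Proof. by rewrite /frob -{1}[X]vsubmxK tr_col_mx mul_row_col mxtraceD. Qed.

Lemma frob_row m n1 n2 (X : 'M[R]_(m, n1 + n2)) Y Z :
  frob X (row_mx Y Z) = frob (lsubmx X) Y + frob (rsubmx X) Z.
Proof. by rewrite /frob -{1}[X]hsubmxK tr_row_mx mul_col_row mxtrace_block. Qed.

Lemma frob_block m1 m2 n1 n2 (X : 'M[R]_(m1 + m2, n1 + n2)) Y Z T U :
  frob X (block_mx Y Z T U) = frob (ulsubmx X) Y + frob (ursubmx X) Z
    + (frob (dlsubmx X) T + frob (drsubmx X) U).
Proof. by rewrite frob_col !frob_row. Qed.

(* The adjoint (costate) method: the observability Gramian [Q] eliminates the
   derivative [dP] of the controllability Gramian. *)
Lemma dcost_adjoint k m p0 (A P Q dA dP : 'M[R]_k) (B dB : 'M[R]_(k, m))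
    (C dC : 'M[R]_(p0, k)) :
  P^T = P -> Q^T = Q -> A^T *m Q + Q *m A + C^T *m C = 0 ->
  dA *m P + A *m dP + (dP *m A^T + P *m dA^T) + (dB *m B^T + B *m dB^T) = 0 ->
  \tr ((dC *m P + C *m dP) *m C^T + C *m P *m dC^T) =
  2 * (frob (Q *m P) dA + frob (Q *m B) dB + frob (C *m P) dC).
Proof.
move=> PT QT HQ HP.
have e1 : \tr (C *m dP *m C^T) = frob (C^T *m C) dP.
  by rewrite /frob trmx_mul trmxK mxtrace_mulC mulmxA.
(* The equation of [Q] replaces [C^T *m C], and the Lyapunov operator is moved onto [dP] by
   adjunction. *)
have e2 : frob (C^T *m C) dP = - frob Q (A *m dP + dP *m A^T).
  move/eqP: HQ; rewrite addrC addr_eq0 => /eqP ->.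
  by rewrite frobNl frobDl frobDr frob_mull frob_mulr trmxK.
have e3 : - (A *m dP + dP *m A^T) = dA *m P + P *m dA^T + (dB *m B^T + B *m dB^T).
  apply/eqP; rewrite eq_sym -subr_eq0 opprK -HP; apply/eqP.
  by rewrite addrAC; congr (_ + _); rewrite addrACA; congr (_ + _); rewrite addrC.
have e4 : \tr (dC *m P *m C^T) = frob (C *m P) dC.
  by rewrite /frob trmx_mul PT -mulmxA mxtrace_mulC.
have e5 : \tr (C *m P *m dC^T) = frob (C *m P) dC.
  by rewrite -e4 -mxtrace_tr !trmx_mul trmxK PT mulmxA.
rewrite mulmxDl !mxtraceD e1 e2 -frobNr e3 e4 e5 !frobDr.
rewrite (_ : frob Q (P *m dA^T) = frob (Q *m P) dA); last first.
  by rewrite frob_mull frob_tr trmx_mul trmxK QT.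
rewrite (_ : frob Q (B *m dB^T) = frob (Q *m B) dB); last first.
  by rewrite frob_mull frob_tr trmx_mul trmxK QT.
rewrite !(frob_mulr Q) PT trmxK.
ring.
Qed.

(** Testing against [N^T + N], which is symmetric, shows that its own norm vanishes; conversely,
    transposing the pairing changes its sign. *)
Lemma frob_sym_eq0 k (N : 'M[R]_k) :
  (forall X, sym_mx X -> frob N X = 0) <-> antisym_mx N.
Proof.
split=> [H|NT X XT].
  apply/eqP; rewrite -subr_eq0 opprK; apply/eqP/frob_eq0.
  have S : sym_mx (N^T + N) by rewrite /sym_mx linearD /= trmxK addrC.
  by rewrite frobDl -frob_tr S H // addr0.
have : frob N X = - frob N X by rewrite -{1}XT frob_tr NT frobNl.
by move/eqP; rewrite -subr_eq0 opprK -mulr2n mulrn_eq0 /= => /eqP.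
Qed.

End FrobeniusProduct.

(** * Algebra of the canonical antisymmetric matrix *)

Section CanonicalJ.
Variable R : realType.

Lemma canonJ_tr k : (canonJ R k)^T = - canonJ R k.
Proof.
apply/matrixP => i j; rewrite !mxE.
case: (boolP (odd j)) => oj; case: (boolP (odd i)) => oi /=;
  do ?[case: eqP => [?|?]]; rewrite ?oppr0 ?opprK //; exfalso; lia.
Qed.

Lemma canonJ_sqr k : canonJ R k *m canonJ R k = - 1%:M.
Proof.
(* Row [i] has one nonzero entry, in the column of the other index of its 2 by 2 block. This partner
   map is an involution that flips parity, so the two signs met in the square multiply to -1. *)
have lt_partner (i : 'I_k.*2) : ((if odd i then i.-1 else i.+1) < k.*2)%N.
  by have := ltn_ord i; case: ifP => oi; lia.
pose partner i := Ordinal (lt_partner i).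
have JE i j : canonJ R k i j = if j == partner i then (-1) ^+ odd i else 0.
  rewrite mxE -val_eqE /=.
  by case: (boolP (odd i)) => oi /=; do ?[case: eqP => [?|?]] => //; exfalso; lia.
apply/matrixP => i j; rewrite mxE (bigD1 (partner i)) //= big1 => [|l li].
  have op : odd (partner i) = ~~ odd i by rewrite /=; case: ifP; lia.
  have pp : partner (partner i) = i.
    by apply: val_inj; rewrite /= op /=; case: (boolP (odd i)) => oi /=; lia.
  rewrite !JE eqxx addr0 !mxE pp op eq_sym.
  case: eqP => _; last by rewrite mulr0 oppr0.
  by case: (odd i); rewrite /= ?mulr1 ?mul1r.
by rewrite JE (negbTE li) mul0r.
Qed.
End CanonicalJ.

(** * Gradient of the cost and the critical point equations *)

Section Gradient.
Variables (R : realType) (nu mu1 mu2 p p0 : nat)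
  (A : 'M[R]_(nu.*2)) (B1 : 'M[R]_(nu.*2, mu1.*2)) (B2 : 'M[R]_(nu.*2, mu2.*2))
  (C : 'M[R]_(p, nu.*2)) (D : 'M[R]_(p, mu1.*2)) (C0 : 'M[R]_(p0, nu.*2))
  (D0 : 'M[R]_(p0, mu2.*2))
  (Rm : 'M[R]_(nu.*2)) (b : 'M[R]_(nu.*2, mu2.*2 + p)).
Hypothesis hA : hurwitz (Acl A B2 C D Rm b).
Notation V := ('M[R]_(nu.*2) * 'M[R]_(nu.*2, mu2.*2 + p))%type.
Notation J0 := (J0 R nu).
Notation J2 := (J2 R mu2).
Notation J := (Jbig mu2 D).
Notation Ib := (Ibold R mu2 p).
Notation Cb := (Cbold mu2 C).
Notation Db := (Dbold mu2 D).
Notation B := (Bfull B1 B2).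
Notation P := (Pcl A B1 B2 C D Rm b).
Notation Q := (Qcl A B2 C D C0 D0 Rm b).

Definition dctrl_a dR db : 'M[R]_(nu.*2) :=
  J0 *m dR + 2^-1 *: ((db *m J *m b^T + b *m J *m db^T) *m J0).

(** The map [ctrl_c] is linear in [b], so it is its own derivative; only [ctrl_a] has a quadratic
    term. *)
Definition dAcl dR db : 'M[R]_(nu.*2 + nu.*2) :=
  block_mx 0 (B2 *m ctrl_c db) (db *m Cb) (dctrl_a dR db).

Definition dBcl (db : 'M[R]_(nu.*2, mu2.*2 + p)) :
    'M[R]_(nu.*2 + nu.*2, mu1.*2 + mu2.*2) :=
  col_mx 0 (db *m Db).

Definition dCcl (db : 'M[R]_(nu.*2, mu2.*2 + p)) : 'M[R]_(p0, nu.*2 + nu.*2) :=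
  row_mx 0 (D0 *m ctrl_c db).

Definition dEcost dR db : R :=
  2 * (frob (Q *m P) (dAcl dR db) + frob (Q *m Bcl B1 B2 D b) (dBcl db)
       + frob (Ccl C0 D0 b *m P) (dCcl db)).

Section Differentials.
Variable v : V.
Let x : V := (Rm, b).

Lemma ctrl_c_has_diff : mx_has_diff x v (fun y : V => ctrl_c y.2) (ctrl_c v.2).
Proof. by apply/mx_has_diffMr/mx_has_diffMl/mx_has_diff_tr/mx_has_diff_snd. Qed.

Lemma ctrl_a_has_diff :
  mx_has_diff x v (fun y : V => ctrl_a D y.1 y.2) (dctrl_a v.1 v.2).
Proof.
apply: mx_has_diffD; first exact/mx_has_diffMl/mx_has_diff_fst.
apply/mx_has_diffZ/mx_has_diffMr.
apply: (@mx_has_diffM _ _ _ _ _ _ _ (fun y : V => y.2 *m J)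
  (fun y : V => y.2^T)).
  exact/mx_has_diffMr/mx_has_diff_snd.
exact/mx_has_diff_tr/mx_has_diff_snd.
Qed.

Lemma Acl_has_diff :
  mx_has_diff x v (fun y : V => Acl A B2 C D y.1 y.2) (dAcl v.1 v.2).
Proof.
apply: mx_has_diff_block.
- exact: mx_has_diff_cst.
- exact/mx_has_diffMl/ctrl_c_has_diff.
- exact/mx_has_diffMr/mx_has_diff_snd.
- exact: ctrl_a_has_diff.
Qed.

Lemma Bcl_has_diff : mx_has_diff x v (fun y : V => Bcl B1 B2 D y.2) (dBcl v.2).
Proof.
apply: mx_has_diff_col; first exact: mx_has_diff_cst.
exact/mx_has_diffMr/mx_has_diff_snd.
Qed.

Lemma Ccl_has_diff : mx_has_diff x v (fun y : V => Ccl C0 D0 y.2) (dCcl v.2).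
Proof.
apply: mx_has_diff_row; first exact: mx_has_diff_cst.
exact/mx_has_diffMl/ctrl_c_has_diff.
Qed.

Lemma Efun_has_diff :
  has_diff x v (Efun A B1 B2 C D C0 D0) (dEcost v.1 v.2).
Proof.
have Ad := Acl_has_diff; have Bd := Bcl_has_diff; have Cd := Ccl_has_diff.
have Wd := mx_has_diffM Bd (mx_has_diff_tr Bd).
have [near_unit [dP Pd]] := @mx_differentiable_lyap _ _ x v _
  (fun y : V => Acl A B2 C D y.1 y.2) _ _ _ hA Ad Wd.
have lyap_d := mx_has_diffD (mx_has_diffD (mx_has_diffM Ad Pd)
  (mx_has_diffM Pd (mx_has_diff_tr Ad))) Wd.
have near0 : \forall y \near x, Acl A B2 C D y.1 y.2 *m Pcl A B1 B2 C D y.1 y.2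
    + Pcl A B1 B2 C D y.1 y.2 *m (Acl A B2 C D y.1 y.2)^T
    + Bcl B1 B2 D y.2 *m (Bcl B1 B2 D y.2)^T = 0.
  by apply: filterS near_unit => y yU; exact: lyapP.
(* The left-hand side of the equation of [P] is locally constant, so its derivative, computed by the
   product rule, is 0. This is the only relation on [dP] that is used. *)
have HP := mx_has_diff_uniq
  (@near_eq_mx_has_diff _ _ x v _ _ _ (fun=> 0) _ near0 lyap_d)
  (mx_has_diff_cst x v 0).
have hAT := hurwitz_tr hA.
have PT : P^T = P by apply: lyap_sym => //; rewrite trmx_mul trmxK.
have QT : Q^T = Q by apply: lyap_sym => //; rewrite trmx_mul trmxK.
have HQ := lyapP ((Ccl C0 D0 b)^T *m Ccl C0 D0 b) (lyap_mx_unit hAT).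
rewrite trmxK in HQ.
rewrite /dEcost -(dcost_adjoint (dCcl v.2) PT QT HQ HP).
exact: (has_diff_mxtrace (mx_has_diffM (mx_has_diffM Cd Pd) (mx_has_diff_tr Cd))).
Qed.

End Differentials.

Lemma criticalE : critical A B1 B2 C D C0 D0 Rm b <->
  forall dR db, sym_mx dR -> dEcost dR db = 0.
Proof.
split=> [[_ H] dR db symR|H].
  by rewrite -(Efun_has_diff (dR, db)).2 H.
split; first exact: (Efun_has_diff 0).1.
by move=> dR db symR; rewrite (Efun_has_diff (dR, db)).2 H.
Qed.

(** Half the gradient of the cost in [b], once [Phi] is antisymmetric and the lower right block of
    [Q *m P] is [- (Phi *m J0)]. *)
Definition gradb (Phi : 'M[R]_(nu.*2)) : 'M[R]_(nu.*2, mu2.*2 + p) :=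
  frakM D D0 Phi (drsubmx Q) (drsubmx P) b
      + dlsubmx (Q *m P) *m Cb^T
      + dlsubmx Q *m B *m Db^T
      + J0 *m ((ursubmx (Q *m P))^T *m B2 + dlsubmx P *m C0^T *m D0)
          *m J2 *m Ib^T.

Lemma J0_tr : J0^T = - J0. Proof. exact: canonJ_tr. Qed.

Lemma J1_tr : (J1 R mu1)^T = - J1 R mu1. Proof. exact: canonJ_tr. Qed.

Lemma J2_tr : J2^T = - J2. Proof. exact: canonJ_tr. Qed.

Lemma J0_sqr : J0 *m J0 = - 1%:M. Proof. exact: canonJ_sqr. Qed.

Lemma Jbig_tr : J^T = - J.
Proof.
rewrite /Jbig tr_block_mx !trmx_mul trmxK J1_tr J2_tr !trmx0.
by rewrite opp_block_mx !oppr0 mulNmx mulmxN mulmxA.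
Qed.

Lemma frob_ctrl_c (G : 'M[R]_(mu2.*2, nu.*2)) db :
  frob G (ctrl_c db) = frob (J0 *m G^T *m J2 *m Ib^T) db.
Proof.
rewrite /ctrl_c frob_mulr frob_mull frob_tr !trmx_mul !trmxK.
by rewrite !mulmxA.
Qed.

(** The square of [J0] being [- 1%:M] cancels [J0] in the quadratic term. Antisymmetry of [J] and of
    [Phi] makes its two product-rule summands contribute equally, which absorbs the factor 1/2 and
    leaves the first term of [frakM]. *)
Lemma frob_dctrl_a Phi dR db : antisym_mx Phi ->
  frob (- (Phi *m J0)) (dctrl_a dR db) =
  frob (- (J0^T *m Phi *m J0)) dR + frob (Phi *m b *m J) db.
Proof.
move=> PhiT; rewrite frobDr; congr (_ + _).
  by rewrite frob_mull mulmxN mulmxA.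
rewrite frobZr frob_mulr J0_tr mulmxN mulNmx opprK frobDr.
have -> : Phi *m J0 *m J0 = - Phi by rewrite -mulmxA J0_sqr mulmxN mulmx1.
have -> : frob (- Phi) (db *m J *m b^T) = frob (Phi *m b *m J) db.
  rewrite -mulmxA frob_mulr trmx_mul trmxK Jbig_tr.
  by rewrite !mulmxN !mulNmx opprK mulmxA.
have -> : frob (- Phi) (b *m J *m db^T) = frob (Phi *m b *m J) db.
  by rewrite -PhiT frob_mull frob_tr !trmx_mul !trmxK mulmxA.
by field.
Qed.

Lemma dEcostE Phi dR db : antisym_mx Phi -> drsubmx (Q *m P) = - (Phi *m J0) ->
  dEcost dR db = 2 * (frob (- (J0^T *m Phi *m J0)) dR + frob (gradb Phi) db).
Proof.
move=> PhiT HE.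
have PT : P^T = P by apply: lyap_sym => //; rewrite trmx_mul trmxK.
(* [QB] yields the [Q] terms of [gradb], including the second term of [frakM]; [CP] yields the [P]
   terms, including the third. *)
have QB : dsubmx (Q *m Bcl B1 B2 D b) = dlsubmx Q *m B + drsubmx Q *m b *m Db.
  by rewrite -{1}[Q]submxK mul_block_col col_mxKd mulmxA.
have CP : (rsubmx (Ccl C0 D0 b *m P))^T =
    dlsubmx P *m C0^T + drsubmx P *m J0 *m b *m Ib *m J2 *m D0^T.
  rewrite -{1}[P]submxK mul_row_block row_mxKr linearD /= !trmx_mul !trmxK.
  rewrite trmx_ursub trmx_drsub PT.
  by rewrite J0_tr J2_tr !(mulmxN, mulNmx) opprK !mulmxA.
congr (2 * _); rewrite /dAcl /dBcl /dCcl.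
rewrite frob_block frob_col frob_row !frob0r !add0r HE frob_dctrl_a //.
rewrite [frob _ (B2 *m _)]frob_mull [frob _ (D0 *m _)]frob_mull !frob_ctrl_c.
rewrite [frob _ (_ *m Cb)]frob_mulr [frob _ (_ *m Db)]frob_mulr QB.
rewrite !trmx_mul !trmxK CP /gradb /frakM.
rewrite !(mulmxDl, mulmxDr, frobDl) !mulmxA.
ring.
Qed.
Lemma dEcost_R dR : dEcost dR 0 = 2 * frob (J0^T *m drsubmx (Q *m P)) dR.
Proof.
rewrite /dEcost /dAcl /dBcl /dCcl /dctrl_a /ctrl_c trmx0 !(mul0mx, mulmx0).
rewrite add0r mul0mx scaler0 addr0 col_mx0 row_mx0 !frob0r !addr0.
by rewrite frob_block !frob0r !add0r frob_mull.
Qed.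

Lemma critical_iff_gradb : critical A B1 B2 C D C0 D0 Rm b <->
  exists Phi, antisym_mx Phi /\
    drsubmx (Q *m P) = - (Phi *m J0) /\ gradb Phi = 0.
Proof.
rewrite criticalE; split=> [H|[Phi [PhiT [HE G0]]] dR db symR]; last first.
  (* What remains is the pairing of [dR] with a congruence transform of [Phi], which is
     antisymmetric and so orthogonal to symmetric [dR]. *)
  rewrite (dEcostE _ _ PhiT HE) G0 frob0l addr0.
  rewrite ((frob_sym_eq0 _).2 _ _ symR) ?mulr0 //.
  by rewrite /antisym_mx linearN /= !trmx_mul trmxK PhiT !(mulmxN, mulNmx) mulmxA.
set S := drsubmx (Q *m P).
have ST : antisym_mx (J0^T *m S).
  apply/frob_sym_eq0 => X XT; have := H X 0 XT; rewrite dEcost_R => /eqP.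
  by rewrite mulf_eq0 pnatr_eq0 /= => /eqP.
have PhiT : antisym_mx (S *m J0).
  have {}ST : S^T *m J0 = J0 *m S.
    by move: ST; rewrite /antisym_mx trmx_mul trmxK J0_tr mulNmx opprK.
  (* Multiply [ST] by [J0] on both sides and use that [J0] squares to [- 1%:M]. *)
  have E : S *m J0 = J0 *m S^T.
    rewrite -[LHS]opprK -[S *m J0]mul1mx -mulNmx -J0_sqr -!mulmxA (mulmxA J0 S).
    by rewrite -ST -!mulmxA J0_sqr !mulmxN mulmx1 opprK.
  by rewrite /antisym_mx trmx_mul J0_tr mulNmx E.
have HE : S = - (S *m J0 *m J0) by rewrite -mulmxA J0_sqr mulmxN opprK mulmx1.
(* The witness is forced by solving [S = - (Phi *m J0)] for [Phi]. The gradient vanishes by testing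
   criticality with [dR = 0] and [db] the gradient itself. *)
exists (S *m J0); split=> //; split=> //; apply: frob_eq0.
have symR0 : @sym_mx R nu.*2 0 by exact: trmx0.
have := H 0 (gradb (S *m J0)) symR0.
rewrite (dEcostE _ _ PhiT HE) frob0r add0r => /eqP.
by rewrite mulf_eq0 pnatr_eq0 /= => /eqP.
Qed.

End Gradient.

Theorem theorem1 (R : realType) (nu mu1 mu2 p p0 : nat)
  (A : 'M[R]_(nu.*2)) (B1 : 'M[R]_(nu.*2, mu1.*2)) (B2 : 'M[R]_(nu.*2, mu2.*2))
  (C : 'M[R]_(p, nu.*2)) (D : 'M[R]_(p, mu1.*2)) (C0 : 'M[R]_(p0, nu.*2))
  (D0 : 'M[R]_(p0, mu2.*2))
  (Rm : 'M[R]_(nu.*2)) (b : 'M[R]_(nu.*2, mu2.*2 + p)) :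
  (0 < p)%N -> (0 < p0)%N ->
  sym_mx Rm ->
  hurwitz (Acl A B2 C D Rm b) ->
  let P := Pcl A B1 B2 C D Rm b in
  let Q := Qcl A B2 C D C0 D0 Rm b in
  let H := Q *m P in
  critical A B1 B2 C D C0 D0 Rm b <->
  exists Phi : 'M[R]_(nu.*2),
    antisym_mx Phi /\
    drsubmx H = - (Phi *m J0 R nu) /\
    frakM D D0 Phi (drsubmx Q) (drsubmx P) b
      + dlsubmx H *m (Cbold mu2 C)^T
      + dlsubmx Q *m Bfull B1 B2 *m (Dbold mu2 D)^T
      + J0 R nu *m ((ursubmx H)^T *m B2 + dlsubmx P *m C0^T *m D0)
          *m J2 R mu2 *m (Ibold R mu2 p)^T = 0.
Proof.
by move=> _ _ _ hA P Q H; exact: critical_iff_gradb.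
Qed.
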